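(* Let $\mathfrak{C}$ be a class of graphs closed under the operation of attaching pendant edges (i.e. if $G\in\mathfrak{C}$ and $G'$ is obtained from $G$ by adding a new vertex joined by a single edge to a vertex of $G$, then $G'\in\mathfrak{C}$), and let $f$ be a real-valued function on the positive integers. If $W(G')\leq f(|V(G')|)$ holds for every graph $G'\in\mathfrak{C}\cap\mathfrak{N}$, then for every graph $G\in\mathfrak{C}$ we have $W_{def}(G)\leq f\left(|V(G)|+def(G)\right)$.
   Context: All graphs are finite, undirected, without loops or multiple edges. A proper $t$-edge-coloring of $G$ is a map $\alpha:E(G)\to\{1,\ldots,t\}$ such that all $t$ colors are used and adjacent edges receive different colors. The spectrum $S(v,\alpha)$ of a vertex $v$ is the set of colors on edges incident to $v$. For a finite set $A$ of integers, $def(A)=\max A-\min A-|A|+1$ (the number of integers strictly between $\min A$ and $\max A$ not in $A$; $def(\emptyset)=0$). Define $def(v,\alpha)=def(S(v,\alpha))$, $def(G,\alpha)=\sum_{v\in V(G)}def(v,\alpha)$, and $def(G)=\min_\alpha def(G,\alpha)$ over all proper edge-colorings $\alpha$ of $G$. $W_{def}(G)$ denotes the largest $t$ such that $G$ has a proper $t$-edge-coloring $\alpha$ with $def(G,\alpha)=def(G)$. An interval $t$-coloring is a proper $t$-edge-coloring with every spectrum an interval of integers; $\mathfrak{N}$ is the class of graphs admitting an interval $t$-coloring for some $t$, and for $G\in\mathfrak{N}$, $W(G)$ is the largest $t$ for which $G$ has an interval $t$-coloring. *)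

(* Defs.v *)
From HB Require Import structures.
From mathcomp Require Import all_boot all_order all_algebra finmap.
From mathcomp Require Import boolp reals.

Set Implicit Arguments.
Unset Strict Implicit.
Unset Printing Implicit Defensive.

Local Open Scope fset_scope.
Local Open Scope nat_scope.

(* The null graph is excluded, so the order of a graph is a positive
   integer. *)
Record sgraph := SGraph {
  vertex :> finType;
  adj : rel vertex;
  adj_sym : symmetric adj;
  adj_irr : irreflexive adj;
  vertex_gt0 : 0 < #|vertex|
}.

Definition edges (G : sgraph) : {set {set G}} :=
  [set [set p.1; p.2] | p : G * G & adj p.1 p.2].

Section Pendant.
Variables (G : sgraph) (v : G).

Definition pendant_adj : rel (option G) := fun x y =>
  match x, y with
  | Some a, Some b => adj a b
  | Some a, None | None, Some a => a == v
  | None, None => false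
  end.

Lemma pendant_adj_sym : symmetric pendant_adj.
Proof. by move=> [a|] [b|] //=; exact: adj_sym. Qed.

Lemma pendant_adj_irr : irreflexive pendant_adj.
Proof. by move=> [a|] //=; exact: adj_irr. Qed.

Lemma pendant_gt0 : 0 < #|{: option G}|.
Proof. by rewrite card_option. Qed.

(* G plus one new vertex None, joined to v only. *)
Definition pendant : sgraph :=
  SGraph pendant_adj_sym pendant_adj_irr pendant_gt0.
End Pendant.

(* C is not assumed closed under isomorphism, so only the representative
   `pendant v` of the extended graph is required to lie in C. *)
Definition pendant_closed (C : sgraph -> Prop) : Prop :=
  forall (G : sgraph) (v : G), C G -> C (pendant v).

(* A coloring is a function on all vertex sets; only its values on edges
   matter. An edgeless graph has exactly a proper 0-edge-coloring. *)
Definition proper_edge_coloring (G : sgraph) (t : nat) (alpha : {set G} -> nat)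
    : Prop :=
  [/\ forall e, e \in edges G -> 1 <= alpha e <= t,
      forall c, 1 <= c <= t -> exists2 e, e \in edges G & alpha e = c
    & forall e1 e2, e1 \in edges G -> e2 \in edges G -> e1 != e2 ->
        e1 :&: e2 != finset.set0 -> alpha e1 != alpha e2].

Definition spectrum (G : sgraph) (alpha : {set G} -> nat) (v : G) :
    {fset nat} :=
  [fset alpha e | e in [set e in edges G | v \in e]].

(* Both are used on nonempty sets only: starting the minimum from the maximum
   is then harmless. *)
Definition fset_max (A : {fset nat}) : nat := \max_(i <- A) i.
Definition fset_min (A : {fset nat}) : nat :=
  \big[minn/fset_max A]_(i <- A) i.

(* The truncated subtractions are exact when A is nonempty. *)
Definition set_def (A : {fset nat}) : nat :=
  if A == fset0 then 0 else (fset_max A - fset_min A + 1) - #|` A|.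

Definition coloring_def (G : sgraph) (alpha : {set G} -> nat) : nat :=
  \sum_(v : G) set_def (spectrum alpha v).

Definition is_interval_set (A : {fset nat}) : Prop :=
  forall i j k, i \in A -> k \in A -> i <= j <= k -> j \in A.

Definition interval_coloring (G : sgraph) (t : nat) (alpha : {set G} -> nat)
    : Prop :=
  proper_edge_coloring t alpha /\
  forall v : G, is_interval_set (spectrum alpha v).

Lemma proper_edge_coloring_bound (G : sgraph) t (alpha : {set G} -> nat) :
  proper_edge_coloring t alpha -> t <= #|edges G|.
Proof.
case=> _ surj _.
have sub : {subset iota 1 t <= [seq alpha e | e <- enum (edges G)]}.
  move=> c; rewrite mem_iota add1n ltnS => /surj[e eG <-].
  by apply: map_f; rewrite mem_enum.
by have := uniq_leq_size (iota_uniq 1 t) sub; rewrite size_iota size_map -cardE.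
Qed.

Lemma proper_edge_coloring_exists (G : sgraph) :
  exists t (alpha : {set G} -> nat), proper_edge_coloring t alpha.
Proof.
pose s := enum (edges G); have sE : s =i edges G by exact: mem_enum.
exists (size s), (fun e => (index e s).+1); split.
- by move=> e eG; rewrite ltnS leq0n /= index_mem sE.
- case=> // c /= cs; exists (nth (finset.set0 : {set G}) s c).
    by rewrite -sE mem_nth.
  by rewrite index_uniq ?enum_uniq.
- move=> e1 e2 e1G e2G + _; apply: contra_neq => -[].
  by apply: (@index_inj _ finset.set0 s); rewrite sE.
Qed.

Definition in_N (G : sgraph) : Prop :=
  exists t (alpha : {set G} -> nat), interval_coloring t alpha.

Section W.
Variable G : sgraph.

Definition interval_colorable : pred nat :=
  fun t => `[< exists alpha : {set G} -> nat, interval_coloring t alpha >].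

Lemma interval_colorable_exists : in_N G -> exists t, interval_colorable t.
Proof. by case=> t [alpha ta]; exists t; apply/asboolP; exists alpha. Qed.

Lemma interval_colorable_bound t : interval_colorable t -> t <= #|edges G|.
Proof. by move=> /asboolP[alpha [/proper_edge_coloring_bound]]. Qed.

Definition W (GN : in_N G) : nat :=
  ex_maxn (interval_colorable_exists GN) interval_colorable_bound.
End W.

Section Wdef.
Variable G : sgraph.

Definition attained_def : pred nat :=
  fun d => `[< exists t (alpha : {set G} -> nat),
    proper_edge_coloring t alpha /\ coloring_def alpha = d >].

Lemma attained_def_exists : exists d, attained_def d.
Proof.
have [t [alpha ta]] := proper_edge_coloring_exists G.
by exists (coloring_def alpha); apply/asboolP; exists t, alpha.
Qed.

Definition graph_def : nat := ex_minn attained_def_exists.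

Definition def_colorable : pred nat :=
  fun t => `[< exists alpha : {set G} -> nat,
    proper_edge_coloring t alpha /\ coloring_def alpha = graph_def >].

Lemma def_colorable_exists : exists t, def_colorable t.
Proof.
have [t [alpha ta]] : exists t (alpha : {set G} -> nat),
    proper_edge_coloring t alpha /\ coloring_def alpha = graph_def.
  by rewrite /graph_def; case: ex_minnP => d /asboolP.
by exists t; apply/asboolP; exists alpha.
Qed.

Lemma def_colorable_bound t : def_colorable t -> t <= #|edges G|.
Proof. by move=> /asboolP[alpha [/proper_edge_coloring_bound]]. Qed.

Definition Wdef : nat := ex_maxn def_colorable_exists def_colorable_bound.
End Wdef.

(* Main.v *)
Require Import Defs.
From mathcomp Require Import all_boot all_order all_algebra.
From mathcomp Require Import reals.
From mathcomp Require Import finmap boolp zify.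

(** A proper coloring of positive deficiency has a vertex [v] and a color [c]
    missing from the spectrum of [v] but lying strictly inside its range.  A
    pendant edge of color [c] at [v] lowers the deficiency by exactly one, since
    the new vertex has spectrum [{c}].  Hence a coloring of deficiency [d]
    extends, with the same colors, to an interval coloring of a graph with [d]
    more vertices, to which the bound on [W] applies. *)

Set Implicit Arguments.
Unset Strict Implicit.
Unset Printing Implicit Defensive.

Local Open Scope fset_scope.
Local Open Scope nat_scope.

(** * Extrema and deficiency of finite sets of naturals *)

Lemma leq_fset_max (A : {fset nat}) i : i \in A -> i <= fset_max A.
Proof. by move=> iA; rewrite /fset_max (big_rem i) //= leq_maxl. Qed.

Lemma bigmaxn_mem (s : seq nat) : s != [::] -> \max_(i <- s) i \in s.
Proof.
elim: s => // a s IHs _; rewrite big_cons inE.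
(* An empty maximum takes the default 0, so a one-element list is treated apart. *)
have [->|/IHs] := eqVneq s [::]; first by rewrite big_nil maxn0 eqxx.
by case: (leqP a (\max_(i <- s) i)) => _ H; rewrite ?H ?eqxx ?orbT.
Qed.

Lemma fset_max_mem (A : {fset nat}) : A != fset0 -> fset_max A \in A.
Proof.
by move=> A0; apply: bigmaxn_mem; rewrite -size_eq0 cardfs_eq0.
Qed.

Lemma geq_fset_min (A : {fset nat}) i : i \in A -> fset_min A <= i.
Proof.
rewrite /fset_min; move: (fset_max A) => m; rewrite -[i \in A]/(i \in enum_fset A).
elim: (enum_fset A) => //= a s IHs; rewrite big_cons inE geq_min.
by case/predU1P=> [->|/IHs->]; rewrite ?leqnn ?orbT.
Qed.

Lemma fset_min_mem (A : {fset nat}) : A != fset0 -> fset_min A \in A.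
Proof.
move=> A0; rewrite /fset_min big_seq.
(* The minimum starts from [fset_max A], so that starting value must itself lie in [A]. *)
apply: (big_ind (fun m => m \in A)) => //; first exact: fset_max_mem.
by move=> x y xA yA; case: (leqP x y).
Qed.

Lemma fset_max_eq (A : {fset nat}) m :
  m \in A -> (forall i, i \in A -> i <= m) -> fset_max A = m.
Proof.
move=> mA ub; apply/eqP; rewrite eqn_leq leq_fset_max // andbT.
by apply/ub/fset_max_mem/fset0Pn; exists m.
Qed.

Lemma fset_min_eq (A : {fset nat}) m :
  m \in A -> (forall i, i \in A -> m <= i) -> fset_min A = m.
Proof.
move=> mA lb; apply/eqP; rewrite eqn_leq geq_fset_min //=.
by apply/lb/fset_min_mem/fset0Pn; exists m.
Qed.

(** Written as a duplicate-free list, the integer hull turns the deficiency into a difference of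
    sizes, open to counting arguments on lists. *)
Definition fset_range (A : {fset nat}) : seq nat :=
  iota (fset_min A) (fset_max A - fset_min A + 1).

Lemma mem_fset_range (A : {fset nat}) i : A != fset0 ->
  (i \in fset_range A) = (fset_min A <= i <= fset_max A).
Proof.
by move=> /fset_min_mem/leq_fset_max; rewrite mem_iota; lia.
Qed.

Lemma sub_fset_range (A : {fset nat}) : {subset A <= fset_range A}.
Proof.
move=> i iA; rewrite mem_fset_range ?geq_fset_min ?leq_fset_max //.
by apply/fset0Pn; exists i.
Qed.

Lemma card_fset_range (A : {fset nat}) : #|` A| <= size (fset_range A).
Proof. by apply: uniq_leq_size => //; exact: sub_fset_range. Qed.

Lemma set_defE (A : {fset nat}) : A != fset0 ->
  set_def A = size (fset_range A) - #|` A|.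
Proof. by move=> /negPf A0; rewrite /set_def A0 size_iota. Qed.

Lemma set_def_eq0 (A : {fset nat}) : set_def A = 0 -> is_interval_set A.
Proof.
move=> dA i j k iA kA ijk.
have A0 : A != fset0 by apply/fset0Pn; exists i.
have sz : size (fset_range A) <= #|` A| by rewrite -subn_eq0 -set_defE // dA.
(* A duplicate-free list contained in one that is no longer has the same elements. *)
have [_ ->] := uniq_min_size (fset_uniq A) (@sub_fset_range A) sz.
rewrite mem_fset_range //.
have := geq_fset_min iA; have := leq_fset_max kA; lia.
Qed.

(** If [A] contained its whole range, counting would make the deficiency zero. The bounds on [c] are
    in effect strict, as both extrema belong to [A]. *)
Lemma set_def_gt0 (A : {fset nat}) : 0 < set_def A ->
  exists2 c, c \notin A & fset_min A <= c <= fset_max A.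
Proof.
move=> dA; have A0 : A != fset0.
  by apply: contraTneq dA => ->; rewrite /set_def eqxx.
have /allPn[c cR cA] : ~~ all (mem A) (fset_range A).
  apply: contraTN dA => /allP sub; rewrite set_defE // -leqNgt leqn0 subn_eq0.
  exact: uniq_leq_size (iota_uniq _ _) sub.
by exists c; rewrite -?mem_fset_range.
Qed.

(** Filling a gap keeps both extrema, hence the range, while the cardinality grows by one. *)
Lemma set_def_fsetU1 (A : {fset nat}) c : A != fset0 ->
  c \notin A -> fset_min A <= c <= fset_max A ->
  set_def A = (set_def (c |` A)).+1.
Proof.
move=> A0 cA /andP[mc cM].
have cA0 : c |` A != fset0 by apply/fset0Pn; exists c; rewrite !inE eqxx.
have maxE : fset_max (c |` A) = fset_max A.
  apply: fset_max_eq; first by rewrite !inE fset_max_mem ?orbT.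
  by move=> i; rewrite !inE => /orP[/eqP->//|]; exact: leq_fset_max.
have minE : fset_min (c |` A) = fset_min A.
  apply: fset_min_eq; first by rewrite !inE fset_min_mem ?orbT.
  by move=> i; rewrite !inE => /orP[/eqP->//|]; exact: geq_fset_min.
(* The larger set still fits in the common range, so the truncated difference for [A] is at least 1
   and the successor is exact. *)
have := card_fset_range (c |` A); rewrite !set_defE //.
by rewrite /fset_range minE maxE cardfsU1 cA; lia.
Qed.

Lemma set_def_fset1 c : set_def [fset c] = 0.
Proof.
have c0 : [fset c] != fset0 by apply/fset0Pn; exists c; rewrite inE.
rewrite set_defE // size_iota cardfs1.
rewrite (@fset_max_eq _ c) ?(@fset_min_eq _ c) ?inE ?subnn // => i;
  by rewrite inE => /eqP->.
Qed.

(** * Spectra, the bound by [W], and sums over an extended vertex set *)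

Lemma spectrumP (G : sgraph) (alpha : {set G} -> nat) (v : G) c :
  reflect (exists e, [/\ e \in edges G, v \in e & c = alpha e])
          (c \in spectrum alpha v).
Proof.
apply: (iffP (imfsetP _ _ _ _)) => [[e]|[e [eG ve ->]]].
  by rewrite !inE => /andP[eG ve] ->; exists e.
by exists e => //; rewrite !inE eG.
Qed.

Lemma interval_coloring_W (G : sgraph) (GN : in_N G) t alpha :
  @interval_coloring G t alpha -> t <= W GN.
Proof.
rewrite /W; case: ex_maxnP => m _ ub ta.
by apply: ub; apply/asboolP; exists alpha.
Qed.

Lemma sum_option (T : finType) (F : option T -> nat) :
  \sum_x F x = F None + \sum_x F (Some x).
Proof.
rewrite (bigD1 None) //=; congr (_ + _).
(* The identity of [option T] serves as the partial inverse of [Some]. *)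
rewrite (reindex_omap Some id) /=; last by case.
by apply: eq_bigl => x; rewrite eqxx.
Qed.

(** * Coloring a pendant edge *)

Section PendantColoring.
Variables (G : sgraph) (v : G) (alpha : {set G} -> nat) (c : nat).

Lemma pendant_edgesP (e' : {set pendant v}) :
  reflect ((exists2 e : {set G}, e \in edges G & e' = [set Some x | x in e])
           \/ e' = [set Some v; None])
          (e' \in edges (pendant v)).
Proof.
apply: (iffP idP).
  case/imsetP=> -[[a|] [b|]]; rewrite inE //= => ab ->.
  - left; exists [set a; b]; last by rewrite imsetU1 imset_set1.
    by apply/imsetP; exists (a, b); rewrite ?inE.
  - by right; rewrite (eqP ab).
  - by right; rewrite (eqP ab) finset.setUC.
case=> [[e /imsetP[[a b]]]|->].
  rewrite inE /= => ab -> ->; rewrite imsetU1 imset_set1.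
  by apply/imsetP; exists (Some a, Some b); rewrite ?inE.
by apply/imsetP; exists (Some v, None); rewrite ?inE /=.
Qed.

(** Among edges, only the new one contains [None]; every other edge is pulled back along [Some]. *)
Definition pendant_coloring (e' : {set pendant v}) : nat :=
  if None \in e' then c else alpha [set x | Some x \in e'].

Lemma Some_imset (e : {set G}) x : (Some x \in [set Some y | y in e]) = (x \in e).
Proof. by apply: mem_imset => ? ? []. Qed.

Lemma None_imset (e : {set G}) : (None \in [set Some y | y in e]) = false.
Proof. by apply/negP => /imsetP[]. Qed.

Lemma pendant_coloring_old (e : {set G}) :
  pendant_coloring [set Some x | x in e] = alpha e.
Proof.
rewrite /pendant_coloring None_imset; congr alpha.
by apply/setP => x; rewrite inE Some_imset.
Qed.

Lemma pendant_coloring_new : pendant_coloring [set Some v; None] = c.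
Proof. by rewrite /pendant_coloring !inE. Qed.

Lemma spectrum_pendant_None :
  spectrum pendant_coloring (None : pendant v) = [fset c].
Proof.
apply/fsetP => k; rewrite inE; apply/spectrumP/eqP => [[e' [+ + ->]]|->].
  case/pendant_edgesP => [[e _ ->]|-> _]; last exact: pendant_coloring_new.
  by rewrite None_imset.
exists [set Some v; None]; rewrite pendant_coloring_new !inE; split=> //.
by apply/pendant_edgesP; right.
Qed.

Lemma spectrum_pendant_Some (u : G) :
  spectrum pendant_coloring (Some u : pendant v) =
  if u == v then c |` spectrum alpha u else spectrum alpha u.
Proof.
(* Both cases become a union, whose two sides match the new edge and the old edges. *)
have -> : (if u == v then c |` spectrum alpha u else spectrum alpha u) =
    (if u == v then [fset c] else fset0) `|` spectrum alpha u.
  by case: ifP; rewrite ?fset0U.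
apply/fsetP => k; rewrite inE; apply/spectrumP/orP => [[e' [+ + ->]]|].
  case/pendant_edgesP => [[e eG ->]|->].
    rewrite Some_imset pendant_coloring_old => ue; right.
    by apply/spectrumP; exists e.
  rewrite pendant_coloring_new !inE orbF => /eqP[->].
  by left; rewrite eqxx inE.
case=> [|/spectrumP[e [eG ue ->]]]; last first.
  exists [set Some x | x in e]; rewrite Some_imset pendant_coloring_old.
  by split=> //; apply/pendant_edgesP; left; exists e.
case: eqVneq => [->|_]; rewrite !inE // => /eqP->.
exists [set Some v; None]; rewrite pendant_coloring_new !inE eqxx; split=> //.
by apply/pendant_edgesP; right.
Qed.

Hypothesis c_notin : c \notin spectrum alpha v.

Lemma pendant_coloring_proper t : 1 <= c <= t ->
  proper_edge_coloring t alpha -> proper_edge_coloring t pendant_coloring.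
Proof.
move=> ct [rng surj prop].
(* An old edge can meet the new one only in [v], so its color lies in the spectrum of [v], which
   omits [c]. *)
have old_new (e : {set G}) : e \in edges G ->
    [set Some x | x in e] :&: [set Some v; None] != finset.set0 ->
    alpha e != c.
  move=> eG /set0Pn[[x|]]; rewrite inE ?None_imset // Some_imset !inE orbF.
  case/andP=> xe /eqP[xv]; apply: contraNneq c_notin => <-.
  by apply/spectrumP; exists e; rewrite -xv.
split=> [e' /pendant_edgesP[[e eG ->]|->]|k /surj[e eG <-]|e1' e2'].
- by rewrite pendant_coloring_old rng.
- by rewrite pendant_coloring_new.
- exists [set Some x | x in e]; last exact: pendant_coloring_old.
  by apply/pendant_edgesP; left; exists e.
- case/pendant_edgesP => [[e1 e1G ->]|->];
    case/pendant_edgesP => [[e2 e2G ->]|->];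
    rewrite ?pendant_coloring_old ?pendant_coloring_new.
  + move=> ne12 /set0Pn[[x|]]; rewrite inE ?None_imset // !Some_imset => x12.
    apply: prop => //; first by apply: contraNneq ne12 => ->.
    by apply/set0Pn; exists x; rewrite inE.
  + by move=> _; exact: old_new.
  + by move=> _; rewrite finset.setIC [c == _]eq_sym; exact: old_new.
  + by rewrite eqxx.
Qed.

(** The new vertex contributes 0, the term of [v] drops by one, and all other spectra are
    unchanged. *)
Lemma pendant_coloring_def : spectrum alpha v != fset0 ->
  fset_min (spectrum alpha v) <= c <= fset_max (spectrum alpha v) ->
  coloring_def alpha = (coloring_def pendant_coloring).+1.
Proof.
move=> S0 cS; rewrite /coloring_def sum_option /=.
rewrite spectrum_pendant_None set_def_fset1 add0n.
rewrite (bigD1 v) //= [in RHS](bigD1 v) //= spectrum_pendant_Some eqxx.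
rewrite (set_def_fsetU1 S0 c_notin cS) addSn; congr (_ + _).+1.
by apply: eq_bigr => u /negPf uv; rewrite spectrum_pendant_Some uv.
Qed.

End PendantColoring.

(** * Extension to an interval coloring and the bound *)

Lemma interval_extension (C : sgraph -> Prop) (C_closed : pendant_closed C)
    (d t : nat) (G : sgraph) (alpha : {set G} -> nat) :
  C G -> proper_edge_coloring t alpha -> coloring_def alpha = d ->
  exists (G' : sgraph) (beta : {set G'} -> nat),
    [/\ C G', #|G'| = #|G| + d & interval_coloring t beta].
Proof.
(* Each step changes the graph and its coloring, so both are generalized; [t] stays fixed because no
   new color appears. *)
elim: d => [|d IHd] in G alpha * => CG ta da.
  exists G, alpha; rewrite addn0; split=> //; split=> // v.
  apply: set_def_eq0; apply/eqP; rewrite -leqn0 -da.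
  by rewrite /coloring_def (bigD1 v) //= leq_addr.
have [v dv] : exists v : G, 0 < set_def (spectrum alpha v).
  apply/existsP; apply: contraPT da => /existsPn d0.
  by rewrite /coloring_def big1 // => v _; have := d0 v; rewrite lt0n negbK => /eqP.
have [c cS cb] := set_def_gt0 dv.
have S0 : spectrum alpha v != fset0.
  by apply: contraTneq dv => ->; rewrite /set_def eqxx.
have S_le k : k \in spectrum alpha v -> 1 <= k <= t.
  by case/spectrumP=> e [eG _ ->]; case: ta => rng _ _; exact: rng.
(* The missing color lies between two colors actually used at [v]. *)
have ct : 1 <= c <= t.
  by move: (S_le _ (fset_min_mem S0)) (S_le _ (fset_max_mem S0)); lia.
have [||G' [beta [CG' cardG' tb]]] :=
  IHd (pendant v) (pendant_coloring alpha c) (C_closed _ v CG).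
- exact: pendant_coloring_proper.
- by apply/eqP; rewrite -eqSS -da -pendant_coloring_def.
- by exists G', beta; split=> //; rewrite cardG' card_option addSnnS.
Qed.

Theorem theorem2p1 (R : realType) (C : sgraph -> Prop) (f : nat -> R)
    (C_closed : pendant_closed C)
    (W_le : forall (G' : sgraph) (G'_N : in_N G'),
      C G' -> ((W G'_N)%:R <= f #|G'|)%R)
    (G : sgraph) (G_C : C G) :
  ((Wdef G)%:R <= f (#|G| + graph_def G)%N)%R.
Proof.
rewrite /Wdef; case: ex_maxnP => t /asboolP[alpha [ta da]] _.
(* Since [f] is arbitrary, its argument must be exactly the order of [G']; the equation on cardinals
   is therefore rewritten into the goal. *)
have [G' [beta [CG' <- tb]]] := interval_extension C_closed G_C ta da.
have G'_N : in_N G' by exists t, beta.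
apply: (Order.POrderTheory.le_trans _ (W_le G' G'_N CG')).
by rewrite Num.Theory.ler_nat (interval_coloring_W G'_N tb).
Qed.
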